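(* Let $m\ge 1$ and let $E\subseteq S^m$ be a countable set. Then $E\in\mathrm{CL}(m)$ if and only if there exists an ordinal $\chi$ such that $E^\chi=\emptyset$, where the sets $E^\chi$ ($\chi\ge 1$ an ordinal) are defined by transfinite induction by $$E^1=E,\qquad E^{\chi+1}=E^\chi\setminus \Lambda_c\bigl(H^{m+1}\setminus \overline{\mathrm{co}}(E^\chi)\bigr),\qquad E^\chi=\bigcap_{\psi<\chi}E^\psi\ \text{ for a limit ordinal }\chi .$$
   Context: $H^{m+1}$ denotes $(m+1)$-dimensional hyperbolic space with hyperbolic distance $\rho$, and $S^m=\partial H^{m+1}$ its ideal boundary sphere (in the Poincaré ball model, the unit sphere bounding the open unit ball). A sequence $(z_n)$ in $H^{m+1}$ converges ideally to $x\in S^m$ if it converges to $x$ in the Euclidean topology of the closed unit ball. It converges conically to $x\in S^m$ if it converges ideally to $x$ and there is a geodesic ray $\gamma$ in $H^{m+1}$ landing at $x$ such that the distances $\rho(z_n,\gamma)$ are bounded. For $W\subseteq H^{m+1}$, the conical limit set $\Lambda_c(W)$ is the set of all $x\in S^m$ for which there is a sequence of points of $W$ converging conically to $x$. $\mathrm{CL}(m)=\{\Lambda_c(W): W\subseteq H^{m+1}\}$. For $F\subseteq S^m$, $\overline{\mathrm{co}}(F)\subseteq H^{m+1}$ denotes the (closed) hyperbolic convex hull of $F$: the intersection of all closed hyperbolic half-spaces of $H^{m+1}$ whose closure in $H^{m+1}\cup S^m$ contains $F$ (so it is empty if $F$ has at most one point). *)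

(* Defs.v *)
From mathcomp Require Import all_boot all_order all_algebra.
From mathcomp Require Import wochoice all_classical all_reals all_analysis.
Import Order.TTheory GRing.Theory Num.Theory.
Import numFieldNormedType.Exports.

Set Implicit Arguments.
Unset Strict Implicit.
Unset Printing Implicit Defensive.

Local Open Scope classical_set_scope.
Local Open Scope ring_scope.

(* The library norm of 'rV[R]_n is the sup norm, whence the definition of the
   Euclidean one; both induce the library topology of 'rV[R]_n. *)
Definition dot (R : realType) (n : nat) (u v : 'rV[R]_n) : R :=
  \sum_(i < n) u 0 i * v 0 i.

Definition enorm (R : realType) (n : nat) (u : 'rV[R]_n) : R :=
  Num.sqrt (dot u u).

(* Poincare ball model of hyperbolic n-space. *)
Definition hyp_space (R : realType) (n : nat) : set 'rV[R]_n :=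
  [set z | enorm z < 1].
Arguments hyp_space R n : clear implicits.

Definition ideal_sphere (R : realType) (n : nat) : set 'rV[R]_n :=
  [set x | enorm x = 1].
Arguments ideal_sphere R n : clear implicits.

Definition arcosh (R : realType) (t : R) : R :=
  ln (t + Num.sqrt (t ^+ 2 - 1)).

Definition hdist (R : realType) (n : nat) (x y : 'rV[R]_n) : R :=
  arcosh (1 + 2 * enorm (x - y) ^+ 2 /
              ((1 - enorm x ^+ 2) * (1 - enorm y ^+ 2))).

Definition geodesic_ray (R : realType) (n : nat) (gamma : R -> 'rV[R]_n) :
    Prop :=
  (forall t : R, 0 <= t -> hyp_space R n (gamma t)) /\
  (forall s t : R, 0 <= s -> 0 <= t ->
     hdist (gamma s) (gamma t) = `|s - t|).

Definition lands_at (R : realType) (n : nat) (gamma : R -> 'rV[R]_n)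
    (x : 'rV[R]_n) : Prop :=
  gamma t @[t --> +oo] --> x.

Definition dist_to_ray (R : realType) (n : nat) (z : 'rV[R]_n)
    (gamma : R -> 'rV[R]_n) : R :=
  inf [set hdist z (gamma t) | t in [set t : R | 0 <= t]].

Definition converges_conically (R : realType) (n : nat)
    (z : nat -> 'rV[R]_n) (x : 'rV[R]_n) : Prop :=
  z k @[k --> \oo] --> x /\
  exists gamma : R -> 'rV[R]_n,
    [/\ geodesic_ray gamma, lands_at gamma x &
        exists C : R, forall k : nat, dist_to_ray (z k) gamma <= C].

Definition conical_limit_set (R : realType) (n : nat) (W : set 'rV[R]_n) :
    set 'rV[R]_n :=
  [set x | ideal_sphere R n x /\
     exists z : nat -> 'rV[R]_n,
       (forall k : nat, W (z k)) /\ converges_conically z x].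

Definition CL (R : realType) (m : nat) : set (set 'rV[R]_m.+1) :=
  [set conical_limit_set W | W in [set W | W `<=` hyp_space R m.+1]].
Arguments CL R m : clear implicits.

(* In the ball model the hyperbolic hyperplanes are the traces of the linear
   hyperplanes and of the spheres orthogonal to the unit sphere; the sphere of
   center c and radius r is orthogonal to it iff |c|^2 = 1 + r^2. *)
Definition closed_half_space (R : realType) (n : nat) (P : set 'rV[R]_n) :
    Prop :=
  (exists2 u : 'rV[R]_n, u != 0 &
     P = hyp_space R n `&` [set z | 0 <= dot u z]) \/
  (exists (c : 'rV[R]_n) (r : R),
     [/\ 0 < r, enorm c ^+ 2 = 1 + r ^+ 2 &
       P = hyp_space R n `&` [set z | enorm (z - c) <= r] \/
       P = hyp_space R n `&` [set z | r <= enorm (z - c)]]).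

(* [closure] is taken in 'rV[R]_n; for a subset of the open unit ball it
   is the closure in the closed unit ball. *)
Definition hyp_hull (R : realType) (n : nat) (F : set 'rV[R]_n) :
    set 'rV[R]_n :=
  hyp_space R n `&`
  \bigcap_(P in [set P | closed_half_space P /\ F `<=` closure P]) P.

Definition derive_set (R : realType) (n : nat) (F : set 'rV[R]_n) :
    set 'rV[R]_n :=
  F `\` conical_limit_set (hyp_space R n `\` hyp_hull F).

Definition wo_lt (T : Type) (le : rel T) (b c : T) : Prop := le b c /\ b <> c.

Definition wo_least (T : Type) (le : rel T) (c : T) : Prop :=
  forall b : T, le c b.

Definition wo_succ (T : Type) (le : rel T) (b c : T) : Prop :=
  wo_lt le b c /\ forall d : T, wo_lt le b d -> le c d.

Lemma wo_anti (T : Type) (le : rel T) : well_order le ->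
  forall b c : T, le b c -> le c b -> b = c.
Proof.
move=> wo b c bc cb.
have rr (x : T) : le x x.
  have [|y [[/asboolP -> yl] _]] := wo (fun y => `[< y = x >]).
    by exists x; apply/asboolP.
  by apply: yl; apply/asboolP.
have [|y [_ yu]] := wo (fun y => `[< y = b \/ y = c >]).
  by exists b; apply/asboolP; left.
have <- : y = b.
  apply: yu; split; first by apply/asboolP; left.
  by move=> d /asboolP[] ->.
apply: yu; split; first by apply/asboolP; right.
by move=> d /asboolP[] ->.
Qed.

Lemma wo_lt_wf (T : Type) (le : rel T) : well_order le ->
  well_founded (wo_lt le).
Proof.
move=> wo a; apply: contrapT => na.
have [|c [[/asboolP nc cl] _]] := wo (fun c => `[< ~ Acc (wo_lt le) c >]).
  by exists a; apply/asboolP.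
apply: nc; constructor => b [bc nbc]; apply: contrapT => nb.
by apply: nbc; apply: (wo_anti wo) => //; apply: cl; apply/asboolP.
Qed.

Lemma wo_succ_inj (T : Type) (le : rel T) : well_order le ->
  forall b b' c : T, wo_succ le b c -> wo_succ le b' c -> b = b'.
Proof.
move=> wo b b' c [[bc nbc] bm] [[b'c nb'c] b'm]; apply: contrapT => nbb'.
have [|y [[/asboolP yE yl] _]] := wo (fun y => `[< y = b \/ y = b' >]).
  by exists b; apply/asboolP; left.
case: yE => yE; subst y.
- apply: nb'c; apply: (wo_anti wo) => //; apply: bm; split=> //.
  by apply: yl; apply/asboolP; right.
- apply: nbc; apply: (wo_anti wo) => //; apply: b'm; split; last by move=> /esym.
  by apply: yl; apply/asboolP; left.
Qed.

(* Transfinite recursion.  A nonzero ordinal is an element c of a well-ordered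
   type T: the ordinal is 1 + (order type of the predecessors of c), so that
   the least element of T stands for 1. *)
Definition derived_step (R : realType) (n : nat) (E : set 'rV[R]_n)
    (T : Type) (le : rel T) (c : T)
    (D : forall b : T, wo_lt le b c -> set 'rV[R]_n) : set 'rV[R]_n :=
  if pselect (wo_least le c) then E else
  match pselect (exists b : T, wo_succ le b c) with
  | left ex => derive_set (D (projT1 (cid ex)) (proj1 (projT2 (cid ex))))
  | right _ => [set x | forall (b : T) (bc : wo_lt le b c), D b bc x]
  end.

Definition derived (R : realType) (n : nat) (E : set 'rV[R]_n)
    (T : Type) (le : rel T) (wo : well_order le) : T -> set 'rV[R]_n :=
  Fix (wo_lt_wf wo) (fun=> set 'rV[R]_n) (@derived_step R n E T le).

Lemma derivedE (R : realType) (n : nat) (E : set 'rV[R]_n)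
    (T : Type) (le : rel T) (wo : well_order le) (c : T) :
  derived E wo c = derived_step E (fun b (_ : wo_lt le b c) => derived E wo b).
Proof.
rewrite /derived Fix_eq // => d f g fg; congr derived_step.
by apply: functional_extensionality_dep => b; apply: funext => bd; apply: fg.
Qed.

Lemma derived_least (R : realType) (n : nat) (E : set 'rV[R]_n)
    (T : Type) (le : rel T) (wo : well_order le) (c : T) :
  wo_least le c -> derived E wo c = E.
Proof. by move=> lc; rewrite derivedE /derived_step; case: pselect. Qed.

Lemma derived_succ (R : realType) (n : nat) (E : set 'rV[R]_n)
    (T : Type) (le : rel T) (wo : well_order le) (b c : T) :
  wo_succ le b c -> derived E wo c = derive_set (derived E wo b).
Proof.
move=> bc; rewrite derivedE /derived_step; case: pselect => [lc|nlc].
  by case: bc => -[bc nbc] _; case: nbc; apply: (wo_anti wo).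
case: pselect => [ex|[]]; last by exists b.
by case: (cid ex) => b' sb' /=; rewrite (wo_succ_inj wo sb' bc).
Qed.

Lemma derived_limit (R : realType) (n : nat) (E : set 'rV[R]_n)
    (T : Type) (le : rel T) (wo : well_order le) (c : T) :
  ~ wo_least le c -> ~ (exists b : T, wo_succ le b c) ->
  derived E wo c = \bigcap_(b in [set b | wo_lt le b c]) derived E wo b.
Proof.
move=> nlc nsc; rewrite derivedE /derived_step.
by case: (pselect (wo_least le c)) => // nl; case: (pselect (exists b, wo_succ le b c)).
Qed.

(* Main.v *)
Require Import Defs.
From mathcomp Require Import all_boot all_order all_algebra.
From mathcomp Require Import ring lra.
From mathcomp Require Import wochoice all_classical all_reals all_analysis.
Import Order.TTheory GRing.Theory Num.Theory.
Import numFieldNormedType.Exports.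

Set Implicit Arguments.
Unset Strict Implicit.
Unset Printing Implicit Defensive.

Local Open Scope classical_set_scope.
Local Open Scope ring_scope.

(** Write [delta(z) = 1 - |z|] for the height of a point of the ball. A point [x]
    of the sphere is a conical limit point of [W] iff some Stolz cone
    [|z - x| <= M delta(z)] contains points of [W] arbitrarily close to [x]
    ([conical_stolz], [stolz_conical]); after this translation only Euclidean
    geometry of caps and half-spaces is left.

    Suppose that the derived sets never vanish. They decrease and [E] is
    countable, so they become stationary at a nonempty [F] with
    [F = derive_set F] ([derived_stabilizes]). Every cone at a point of [F] is
    then eventually contained in the hull of [F], and a point [w] of the hull
    has points of [F] within [3 delta(w)], since otherwise a half-space would
    separate it from [F] ([hull_shadow]). If [E] were the conical limit set of
    [W], then near each point of [F] there would be points [w] of [W] of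
    arbitrarily small height, hence a point of [F] and a whole ball around it in
    the shadow of [w]. Moreover [F] has no isolated points. The Baire category
    argument yields a point in infinitely many shadows, a conical limit point of
    [W], that avoids all points of the countable set [E], which is absurd
    ([no_countable_perfect]).

    Conversely, suppose that the derived sets vanish. Each [x] in [E] has a rank,
    the last index [c] with [x] in the derived set [D c]; so there are points
    outside the hull of [D c] converging conically to [x]. Such a point lies in
    an open half-space whose ideal boundary, a cap, misses [D c]. The cap
    contains a ball of radius comparable to the height of the point and near it
    ([cap_near_half_space]); so the point can be moved within a larger cone at
    [x] until its shadow, of any prescribed aperture, is contained in the cap
    ([deep_points]). Let [W] consist of such points, with apertures tending to
    infinity and distances to [x] tending to [0] along an enumeration of [E].
    A conical limit point [y] of [W] outside [E] would be approached by points
    of [W] attached to infinitely many elements of [E]. The caps of these points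
    contain [y], hence the elements of [E] appearing later, whose ranks
    therefore keep decreasing: this contradicts well-foundedness
    ([vanishing_derived_CL]). *)

(** * Euclidean geometry of row vectors *)

Lemma dotC (R : realType) n (u v : 'rV[R]_n) : dot u v = dot v u.
Proof. by apply: eq_bigr => i _; rewrite mulrC. Qed.

Lemma dotDl (R : realType) n (u v w : 'rV[R]_n) :
  dot (u + v) w = dot u w + dot v w.
Proof. by rewrite /dot -big_split; apply: eq_bigr => i _; rewrite mxE mulrDl. Qed.

Lemma dotZl (R : realType) n (a : R) (u w : 'rV[R]_n) :
  dot (a *: u) w = a * dot u w.
Proof. by rewrite /dot mulr_sumr; apply: eq_bigr => i _; rewrite mxE mulrA. Qed.

Lemma dotNl (R : realType) n (u w : 'rV[R]_n) : dot (- u) w = - dot u w.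
Proof. by rewrite -scaleN1r dotZl mulN1r. Qed.

Lemma dotDr (R : realType) n (u v w : 'rV[R]_n) :
  dot w (u + v) = dot w u + dot w v.
Proof. by rewrite dotC dotDl !(dotC _ w). Qed.

Lemma dotZr (R : realType) n (a : R) (u w : 'rV[R]_n) :
  dot w (a *: u) = a * dot w u.
Proof. by rewrite dotC dotZl (dotC _ w). Qed.

Lemma dotNr (R : realType) n (u w : 'rV[R]_n) : dot w (- u) = - dot w u.
Proof. by rewrite dotC dotNl (dotC _ w). Qed.

Definition dotE := (dotDl, dotDr, dotZl, dotZr, dotNl, dotNr).

Lemma dot_ge0 (R : realType) n (u : 'rV[R]_n) : 0 <= dot u u.
Proof. by apply: sumr_ge0 => i _; rewrite -expr2 sqr_ge0. Qed.

Lemma dot_eq0 (R : realType) n (u : 'rV[R]_n) : dot u u = 0 -> u = 0.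
Proof.
move=> /eqP; rewrite psumr_eq0; last by move=> i _; rewrite -expr2 sqr_ge0.
move=> /allP h; apply/rowP => i; rewrite mxE.
by apply/eqP; rewrite -(sqrf_eq0 (u 0 i)) expr2; apply: h; rewrite mem_index_enum.
Qed.

Lemma enorm_ge0 (R : realType) n (u : 'rV[R]_n) : 0 <= enorm u.
Proof. exact: sqrtr_ge0. Qed.

Lemma enorm_sq (R : realType) n (u : 'rV[R]_n) : enorm u ^+ 2 = dot u u.
Proof. by rewrite sqr_sqrtr // dot_ge0. Qed.

Lemma enorm_eq0 (R : realType) n (u : 'rV[R]_n) : enorm u = 0 -> u = 0.
Proof. by move=> h; apply: dot_eq0; rewrite -enorm_sq h expr0n. Qed.

Lemma enormZ (R : realType) n (a : R) (u : 'rV[R]_n) :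
  enorm (a *: u) = `|a| * enorm u.
Proof. by rewrite /enorm !dotE mulrA -expr2 sqrtrM ?sqr_ge0 // sqrtr_sqr. Qed.

Lemma enorm0 (R : realType) n : enorm (0 : 'rV[R]_n) = 0.
Proof. by rewrite -(scale0r (0 : 'rV[R]_n)) enormZ normr0 mul0r. Qed.

Lemma enormN (R : realType) n (u : 'rV[R]_n) : enorm (- u) = enorm u.
Proof. by rewrite -scaleN1r enormZ normrN1 mul1r. Qed.

Lemma enorm_distC (R : realType) n (u v : 'rV[R]_n) :
  enorm (u - v) = enorm (v - u).
Proof. by rewrite -enormN opprB. Qed.

Lemma enorm_distE (R : realType) n (u v : 'rV[R]_n) :
  enorm (u - v) ^+ 2 = enorm u ^+ 2 + enorm v ^+ 2 - 2 * dot u v.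
Proof. by rewrite !enorm_sq !dotE (dotC v u); ring. Qed.

Lemma sqr_le (R : realType) (a b : R) : 0 <= b -> a ^+ 2 <= b ^+ 2 -> a <= b.
Proof. by move=> b0 ab; case: (leP a b) => // ba; nra. Qed.

Lemma le_sqr (R : realType) (a b : R) : 0 <= a -> a <= b -> a ^+ 2 <= b ^+ 2.
Proof. by move=> a0 ab; nra. Qed.

Lemma Cauchy_Schwarz (R : realType) n (u v : 'rV[R]_n) :
  dot u v <= enorm u * enorm v.
Proof.
apply: sqr_le; first by rewrite mulr_ge0 ?enorm_ge0.
rewrite exprMn !enorm_sq.
have [v0|vn0] := eqVneq (dot v v) 0.
  by rewrite (dot_eq0 v0) -(scale0r 0) !dotE; lra.
have vp : 0 < dot v v by rewrite lt_neqAle eq_sym vn0 dot_ge0.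
have := dot_ge0 (dot v v *: u - dot u v *: v); rewrite !dotE (dotC v u) => h.
have : 0 <= dot v v * (dot u u * dot v v - dot u v ^+ 2) by lra.
by rewrite pmulr_rge0 // subr_ge0.
Qed.

Lemma enormD (R : realType) n (u v : 'rV[R]_n) :
  enorm (u + v) <= enorm u + enorm v.
Proof.
apply: sqr_le; first by rewrite addr_ge0 ?enorm_ge0.
have := Cauchy_Schwarz u v.
by rewrite sqrrD !enorm_sq !dotE (dotC v u); lra.
Qed.

Lemma enorm_dist_triangle (R : realType) n (v u w : 'rV[R]_n) :
  enorm (u - w) <= enorm (u - v) + enorm (v - w).
Proof. by rewrite -[u - w](subrKA v) enormD. Qed.

Lemma enorm_le_dist (R : realType) n (u v : 'rV[R]_n) :
  enorm u <= enorm v + enorm (u - v).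
Proof. by rewrite -{1}(subrKC v u) enormD. Qed.

Lemma enorm_normalized (R : realType) n (u : 'rV[R]_n) :
  u != 0 -> enorm ((enorm u)^-1 *: u) = 1.
Proof.
move=> un0; have u0 : enorm u != 0 by apply: contra_neq un0 => /enorm_eq0.
by rewrite enormZ ger0_norm ?invr_ge0 ?enorm_ge0 // mulVf.
Qed.

(** The sphere needs positive dimension here: [v] is a tangent direction at [x],
    along which points of the sphere are perturbed later on. *)
Lemma unit_orthogonal (R : realType) m (x : 'rV[R]_m.+1) :
  (1 <= m)%N -> enorm x = 1 -> exists2 v, enorm v = 1 & dot x v = 0.
Proof.
move=> m1 x1.
pose e i : 'rV[R]_m.+1 := delta_mx 0 i.
have dote (w : 'rV[R]_m.+1) i : dot w (e i) = w 0 i.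
  rewrite /dot (bigD1 i) //= big1 => [|j ji]; rewrite !mxE eqxx ?eqxx ?mulr1 ?addr0 //.
  by rewrite (negPf ji) mulr0.
have sumx : x 0 ord0 ^+ 2 + x 0 ord_max ^+ 2 <= 1.
  have := enorm_sq x; rewrite x1 expr1n /dot (bigD1 ord0) //= (bigD1 ord_max) /=.
    set s := \sum_(i < _ | _) _.
    have : 0 <= s by apply: sumr_ge0 => i _; rewrite -expr2 sqr_ge0.
    by move=> + ->; rewrite -!expr2; lra.
  by rewrite -val_eqE /= -lt0n.
have [i xi] : exists i, x 0 i ^+ 2 < 1.
  have [h|h] := ltP (x 0 ord0 ^+ 2) 1; first by exists ord0.
  by exists ord_max; lra.
pose w := e i - x 0 i *: x.
have wn0 : w != 0.
  apply/eqP => w0; have : dot w w = 0 by rewrite w0 -(scale0r 0) dotZl mul0r.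
  rewrite /w !dotE !dote -(enorm_sq x) x1 (dotC (e i)) dote mxE !eqxx /=; nra.
exists ((enorm w)^-1 *: w); first exact: enorm_normalized.
by rewrite dotZr /w !dotE dote -(enorm_sq x) x1 expr1n mulr1 subrr mulr0.
Qed.

(** * The topology of row vectors through the Euclidean norm *)

Lemma exists_invS_lt (R : realType) (e : R) :
  0 < e -> exists N : nat, forall k, (N <= k)%N -> k.+1%:R^-1 < e.
Proof.
move=> e0; exists (Num.bound e^-1) => k Nk.
rewrite invf_plt ?posrE ?ltr0n //.
have := archi_boundP (_ : 0 <= e^-1); rewrite invr_ge0 ltW // => /(_ isT) h.
by apply: lt_le_trans h _; rewrite ler_nat leqW.
Qed.

Lemma coord_le_enorm (R : realType) n (u : 'rV[R]_n) i : `|u 0 i| <= enorm u.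
Proof.
apply: sqr_le; first exact: enorm_ge0.
rewrite real_normK ?num_real // enorm_sq /dot (bigD1 i) //= -expr2 lerDl.
by apply: sumr_ge0 => j _; rewrite -expr2 sqr_ge0.
Qed.

Lemma enorm_lt_coord (R : realType) n (u : 'rV[R]_n) (e : R) : 0 < e ->
  (forall i, `|u 0 i| < e / n.+1%:R) -> enorm u < e.
Proof.
move=> e0 ue; have n0 : (0 : R) < n.+1%:R by rewrite ltr0n.
rewrite ltNge; apply/negP => eu.
have : enorm u ^+ 2 <= n%:R * (e / n.+1%:R) ^+ 2.
  rewrite enorm_sq /dot -[n in n%:R]card_ord -sum1_card natr_sum mulr_suml.
  apply: ler_sum => i _; rewrite mul1r -expr2 -(real_normK (num_real (u 0 i))).
  by apply: lerXn2r; rewrite ?nnegrE //; apply: ltW; rewrite ?ue ?divr_gt0.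
apply/negP; rewrite -ltNge; apply: (@lt_le_trans _ _ (e ^+ 2)); last first.
  by apply: lerXn2r; rewrite ?nnegrE ?enorm_ge0 // ltW.
rewrite expr_div_n mulrCA -[ltRHS]mulr1 ltr_pM2l ?exprn_gt0 //.
rewrite ltr_pdivrMr ?exprn_gt0 // mul1r -natrX ltr_nat.
by rewrite expnS expn1 (leq_trans (ltnSn n)) // leq_pmull.
Qed.

Lemma nbhs_enormP (R : realType) n (x : 'rV[R]_n) (A : set 'rV[R]_n) :
  nbhs x A <-> exists2 e : R, 0 < e & forall y, enorm (y - x) < e -> A y.
Proof.
split=> [/nbhs_ballP[e /= e0 eA]|[e e0 eA]].
  exists e => // y yx; apply: eA; split=> // i j; rewrite ord1 /ball /=.
  apply: le_lt_trans yx; rewrite enorm_distC.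
  by have := coord_le_enorm (x - y) j; rewrite !mxE.
apply/nbhs_ballP; exists (e / n.+1%:R) => /=; first by rewrite divr_gt0 ?ltr0n.
move=> y [_ xy]; apply: eA; apply: enorm_lt_coord => // i.
by have := xy 0 i; rewrite /ball /= distrC !mxE.
Qed.

Lemma cvg_enormP (R : realType) n (T : Type) (F : set_system T) {FF : Filter F}
    (z : T -> 'rV[R]_n) (x : 'rV[R]_n) :
  z @ F --> x <-> forall e : R, 0 < e -> F [set k | enorm (z k - x) < e].
Proof.
split=> [zx e e0|h A /nbhs_enormP[e e0 eA]].
  by apply: (zx [set y | enorm (y - x) < e]); apply/nbhs_enormP; exists e.
by apply: (filterS _ (h e e0)) => k; exact: eA.
Qed.

Lemma closure_enormP (R : realType) n (A : set 'rV[R]_n) (x : 'rV[R]_n) :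
  closure A x <-> forall e : R, 0 < e -> exists2 y, A y & enorm (y - x) < e.
Proof.
split=> [cA e e0|h B /nbhs_enormP[e e0 eB]].
  have [|y [Ay By]] := cA [set y | enorm (y - x) < e]; last by exists y.
  by apply/nbhs_enormP; exists e.
by have [y Ay /eB] := h e e0; exists y.
Qed.

(** The radii tend to [0], so the centres form a Cauchy sequence. *)
Lemma nested_balls (R : realType) n (x : nat -> 'rV[R]_n) (r : nat -> R) :
  (forall k, 0 < r k) -> (forall e, 0 < e -> exists k, r k < e) ->
  (forall k, enorm (x k.+1 - x k) + r k.+1 <= r k) ->
  exists y, forall k, enorm (y - x k) <= r k.
Proof.
move=> r0 r_small xS.
have near j k : enorm (x (k + j)%N - x k) + r (k + j)%N <= r k.
  elim: j => [|j IH]; first by rewrite addn0 subrr enorm0 add0r.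
  rewrite addnS; have := xS (k + j)%N.
  by have := enorm_dist_triangle (x (k + j)%N) (x (k + j).+1) (x k); lra.
have cx : cvg (x @ \oo).
  apply/cauchy_cvgP/cauchy_exP => e e0 /=.
  have [k ke] := r_small (e / n.+1%:R) (divr_gt0 e0 (ltr0Sn R n)).
  exists (x k), k => // j /= kj; split=> // a i; rewrite ord1 /ball /= distrC.
  have := coord_le_enorm (x j - x k) i; rewrite !mxE => /le_lt_trans; apply.
  have := near (j - k)%N k; rewrite subnKC // => h.
  have : r k < e; last by have := r0 j; lra.
  apply: lt_le_trans ke _; rewrite ler_pdivrMr ?ltr0n // ler_peMr ?(ltW e0) //.
  by rewrite ler1n.
exists (lim (x @ \oo)) => k; apply/ler_addgt0Pr => e e0.
have /cvg_enormP/(_ e e0)[N _ hN] := cx.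
have /= := hN (maxn N k) (leq_maxl _ _); rewrite enorm_distC => h1.
have := near (maxn N k - k)%N k; rewrite subnKC ?leq_maxr //.
have := r0 (maxn N k).
have := enorm_dist_triangle (x (maxn N k)) (lim (x @ \oo)) (x k); lra.
Qed.

(** * Conical convergence as Stolz convergence *)

Lemma arcosh_expR (R : realType) (d : R) :
  arcosh ((expR d + expR (- d)) / 2) = `|d|.
Proof.
have E0 := expR_gt0 d; have EN := expRxMexpNx_1 d.
rewrite /arcosh.
have -> : ((expR d + expR (- d)) / 2) ^+ 2 - 1 =
    ((expR d - expR (- d)) / 2) ^+ 2 by rewrite -[X in _ - X]EN; field.
rewrite sqrtr_sqr; have [d0|d0] := leP 0 d.
  have Nd : expR (- d) <= expR d by rewrite ler_expR; lra.
  rewrite ger0_norm; last by lra.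
  have -> : (expR d + expR (- d)) / 2 + (expR d - expR (- d)) / 2 = expR d by lra.
  by rewrite expRK ger0_norm.
have Nd : expR d <= expR (- d) by rewrite ler_expR; lra.
rewrite ler0_norm; last by lra.
have -> : (expR d + expR (- d)) / 2 - (expR d - expR (- d)) / 2 = expR (- d) by lra.
by rewrite expRK ltr0_norm.
Qed.

Lemma arcosh_ge0 (R : realType) (t : R) : 1 <= t -> 0 <= arcosh t.
Proof. by move=> t1; apply: ln_ge0; have := sqrtr_ge0 (t ^+ 2 - 1); lra. Qed.

(** Thanks to this identity, distances only occur through [cosh]. *)
Lemma cosh_arcosh (R : realType) (t : R) :
  1 <= t -> (expR (arcosh t) + expR (- arcosh t)) / 2 = t.
Proof.
move=> t1; have s0 := sqrtr_ge0 (t ^+ 2 - 1).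
have s2 : Num.sqrt (t ^+ 2 - 1) ^+ 2 = t ^+ 2 - 1 by rewrite sqr_sqrtr //; nra.
rewrite /arcosh; set s := Num.sqrt _ in s0 s2 *.
have ts0 : 0 < t + s by lra.
rewrite expRN lnK ?posrE //.
have -> : (t + s)^-1 = t - s.
  by apply: (mulfI (lt0r_neq0 ts0)); rewrite divff ?lt0r_neq0 //; lra.
by lra.
Qed.

Lemma arcosh_le (R : realType) (t u : R) : 1 <= t -> t <= u -> arcosh t <= ln (2 * u).
Proof.
move=> t1 tu; rewrite /arcosh.
have s0 := sqrtr_ge0 (t ^+ 2 - 1).
have st : Num.sqrt (t ^+ 2 - 1) <= t.
  by apply: sqr_le; [lra | rewrite sqr_sqrtr //; nra].
by rewrite ler_ln ?posrE; lra.
Qed.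

Lemma ball_sq (R : realType) n (z : 'rV[R]_n) :
  hyp_space R n z -> 0 < 1 - enorm z ^+ 2.
Proof. by rewrite /hyp_space /= => z1; have := enorm_ge0 z; nra. Qed.

Lemma cosh_hdist_arg (R : realType) n (z w : 'rV[R]_n) :
  hyp_space R n z -> hyp_space R n w ->
  1 <= 1 + 2 * enorm (z - w) ^+ 2 / ((1 - enorm z ^+ 2) * (1 - enorm w ^+ 2)).
Proof.
move=> /ball_sq z1 /ball_sq w1; rewrite lerDl divr_ge0 //.
  by rewrite mulr_ge0 ?sqr_ge0.
by rewrite mulr_ge0 ?ltW.
Qed.

Lemma hdist_ge0 (R : realType) n (z w : 'rV[R]_n) :
  hyp_space R n z -> hyp_space R n w -> 0 <= hdist z w.
Proof. by move=> zH wH; apply/arcosh_ge0/cosh_hdist_arg. Qed.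

Lemma cosh_hdist (R : realType) n (z w : 'rV[R]_n) :
  hyp_space R n z -> hyp_space R n w ->
  2 * enorm (z - w) ^+ 2 = ((expR (hdist z w) + expR (- hdist z w)) / 2 - 1) *
    ((1 - enorm z ^+ 2) * (1 - enorm w ^+ 2)).
Proof.
move=> zH wH; rewrite /hdist cosh_arcosh; last exact: cosh_hdist_arg.
rewrite addrAC subrr add0r mulfVK // mulf_neq0 //.
  by rewrite lt0r_neq0 ?ball_sq.
by rewrite lt0r_neq0 ?ball_sq.
Qed.

Lemma dist_le_hdist (R : realType) n (z w : 'rV[R]_n) (C : R) :
  hyp_space R n z -> hyp_space R n w -> hdist z w <= C ->
  enorm (z - w) ^+ 2 <= 4 * expR C * ((1 - enorm z) * (1 - enorm w)).
Proof.
move=> zH wH dC; have := cosh_hdist zH wH; have d0 := hdist_ge0 zH wH.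
have : expR (hdist z w) <= expR C by rewrite ler_expR.
have : expR (- hdist z w) <= expR (hdist z w) by rewrite ler_expR; lra.
have : 0 < expR (- hdist z w) by apply: expR_gt0.
move: (expR (- _)) (expR (hdist _ _)) => e' e e'0 ee eC.
have z1 : 0 < 1 - enorm z by move: zH; rewrite /hyp_space /=; lra.
have w1 : 0 < 1 - enorm w by move: wH; rewrite /hyp_space /=; lra.
have -> : (1 - enorm z ^+ 2) * (1 - enorm w ^+ 2) =
  (1 - enorm z) * (1 - enorm w) * ((1 + enorm z) * (1 + enorm w)) by ring.
have : 0 < (1 - enorm z) * (1 - enorm w) by apply: mulr_gt0.
have : (1 + enorm z) * (1 + enorm w) <= 4.
  by have := enorm_ge0 z; have := enorm_ge0 w; nra.
have : 0 <= (1 + enorm z) * (1 + enorm w).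
  by rewrite mulr_ge0 // addr_ge0 ?enorm_ge0.
move: ((1 + _) * _) ((1 - _) * _) => b a b0 b4 a0 eqd.
have ab0 : 0 <= a * b by rewrite mulr_ge0 // ltW.
have ab4 : a * b <= 4 * a by nra.
by nra.
Qed.

(** The heights differ by at most [|z - w|], which is controlled by their
    geometric mean. *)
Lemma height_comparable (R : realType) n (z w : 'rV[R]_n) (K : R) :
  hyp_space R n z -> hyp_space R n w -> 0 <= K ->
  enorm (z - w) ^+ 2 <= K * ((1 - enorm z) * (1 - enorm w)) ->
  1 - enorm w <= (2 + 4 * K) * (1 - enorm z).
Proof.
rewrite /hyp_space /= => zH wH K0 h.
have h1 : (enorm z - enorm w) ^+ 2 <= enorm (z - w) ^+ 2.
  have := enorm_le_dist z w; have := enorm_le_dist w z; rewrite (enorm_distC w z).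
  have := enorm_ge0 (z - w); nra.
set p := 1 - enorm z; set q := 1 - enorm w.
have p0 : 0 < p by rewrite /p; lra.
have q0 : 0 < q by rewrite /q; lra.
have {h h1} : (q - p) ^+ 2 <= K * (p * q).
  apply: le_trans h; apply: le_trans h1; rewrite /p /q.
  by have -> : 1 - enorm w - (1 - enorm z) = enorm z - enorm w by ring.
move=> h; case: (leP q ((2 + 4 * K) * p)) => // qp.
have Kp : 0 <= K * p by rewrite mulr_ge0 // ltW.
by nra.
Qed.

(** Writing [cosh s] for the distance from [gamma 0] to [gamma s], the formula
    for the hyperbolic distance shows that [gamma s] has height [exp (- s)] up
    to constants; inserting this into the formula for the distance of [gamma s]
    and [gamma t] and letting [t] tend to infinity bounds the distance from
    [gamma s] to the landing point by a multiple of that height. *)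
Lemma geodesic_ray_stolz (R : realType) n (gamma : R -> 'rV[R]_n) x :
  geodesic_ray gamma -> lands_at gamma x ->
  exists2 K : R, 0 <= K & forall s, 0 <= s ->
    enorm (gamma s - x) <= K * (1 - enorm (gamma s)).
Proof.
move=> [gH gd] gx.
pose a := 1 - enorm (gamma 0) ^+ 2; pose c := (1 - enorm (gamma 0)) ^+ 2.
have a0 : 0 < a by apply: ball_sq; apply: gH.
have a1 : a <= 1 by rewrite /a lerBlDr lerDl sqr_ge0.
have g01 : enorm (gamma 0) < 1 by apply: gH.
have c0 : 0 < c by rewrite exprn_gt0 // subr_gt0.
have K0 : 0 <= 8 / (a * c) by rewrite divr_ge0 // ltW // mulr_gt0.
exists (2 * Num.sqrt (8 / (a * c))); first by rewrite mulr_ge0 ?sqrtr_ge0.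
move=> s s0; have gs1 : enorm (gamma s) < 1 by apply: gH.
have gs0 := enorm_ge0 (gamma s).
pose b := 1 - enorm (gamma s) ^+ 2.
have b0 : 0 < b by apply: ball_sq; apply: gH.
have ch t u : 0 <= t -> t <= u -> 2 * enorm (gamma t - gamma u) ^+ 2 =
    ((expR (u - t) + expR (t - u)) / 2 - 1) *
    ((1 - enorm (gamma t) ^+ 2) * (1 - enorm (gamma u) ^+ 2)).
  move=> t0 tu; have u0 := le_trans t0 tu.
  rewrite cosh_hdist; [|exact: gH|exact: gH].
  by rewrite gd // ler0_norm ?subr_le0 // opprK opprB.
have E1 u : 0 <= u -> 1 <= expR u by move=> u0; have := expR_ge1Dx u; lra.
(* The height of [gamma s] is at least a multiple of [exp (- s)]: this follows
   from [|p - q|^2 + (1 - |p|^2) (1 - |q|^2) >= (1 - |p|)^2]. *)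
have low : c <= b * expR s.
  have := ch 0 s (lexx 0) s0; rewrite subr0 sub0r -/a -/b expRN => h.
  have : enorm (gamma 0 - gamma s) ^+ 2 + a * b >= c.
    rewrite enorm_distE /a /b /c; have := Cauchy_Schwarz (gamma 0) (gamma s).
    move: (dot _ _) (enorm (gamma 0)) (enorm (gamma s)) (enorm_ge0 (gamma 0)) g01 gs0 gs1.
    move=> d p q p0 p1 q0 q1 dpq; have pq : p * q <= p by rewrite ler_piMr // ltW.
    have : (1 - p) ^+ 2 <= (1 - p * q) ^+ 2 by rewrite lerXn2r ?nnegrE; lra.
    by lra.
  have /E1 Es1 := s0; have Es0 := expR_gt0 s.
  have Ei : (expR s)^-1 <= 1 by rewrite invf_le1.
  have ab : 0 < a * b by rewrite mulr_gt0.
  have abE : a * b <= a * b * expR s by rewrite ler_peMr // ltW.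
  have abEi : a * b * (expR s)^-1 <= a * b by rewrite ler_piMr // ltW.
  have : a * (b * expR s) <= b * expR s by rewrite ler_piMl // mulr_ge0 ?ltW.
  by lra.
(* Compare [cosh (t - s) - 1] to [cosh t - 1]: their quotient is at most
   [2 exp (- s)] as soon as [exp t >= 4]. *)
have near_end t : s <= t -> 4 <= expR t ->
    enorm (gamma s - gamma t) <= Num.sqrt (8 / (a * c)) * b.
  move=> st t4; have t0 := le_trans s0 st.
  apply: sqr_le; first by rewrite mulr_ge0 ?sqrtr_ge0 // ltW.
  have -> : (Num.sqrt (8 / (a * c)) * b) ^+ 2 = 8 * b ^+ 2 / (a * c).
    by rewrite exprMn sqr_sqrtr // mulrAC.
  have ac0 : 0 < a * c by apply: mulr_gt0.
  rewrite ler_pdivlMr //.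
  have gt1 : enorm (gamma t) < 1 by apply: gH.
  have d0 : 0 < 1 - enorm (gamma t) ^+ 2 by apply: ball_sq; apply: gH.
  have := ch s t s0 st; have := ch 0 t (lexx 0) t0; rewrite subr0 sub0r -/a -/b.
  have : enorm (gamma 0 - gamma t) ^+ 2 <= 4.
    have := enormD (gamma 0) (- gamma t); rewrite enormN.
    have := enorm_ge0 (gamma 0 - gamma t); nra.
  have := sqr_ge0 (enorm (gamma s - gamma t)).
  move: d0 => + + + + +.
  move: (1 - enorm (gamma t) ^+ 2) (enorm (gamma s - gamma t) ^+ 2)
    (enorm (gamma 0 - gamma t) ^+ 2) => d N N0 d0 N_ge0 N04 h0 hN.
  have Et : expR t = expR s * expR (t - s) by rewrite -expRD addrC subrK.
  have U1 : 1 <= expR (t - s) by apply: E1; lra.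
  have U'1 : expR (s - t) <= 1 by rewrite -expR0 ler_expR; lra.
  have P'0 := expR_gt0 (- t).
  have Q0 := expR_gt0 s.
  have ad0 : 0 < a * d by rewrite mulr_gt0.
  have bd0 : 0 < b * d by rewrite mulr_gt0.
  have h1 : expR t * (a * d) <= 32 by nra.
  have h2 : 4 * N <= expR (t - s) * (b * d) by nra.
  have h3 : 4 * N * expR s <= expR t * (b * d) by rewrite Et; nra.
  have h4 : N * expR s * a <= 8 * b by nra.
  have h5 : c * (N * a) <= b * expR s * (N * a) by rewrite ler_wpM2r // mulr_ge0 // ltW.
  by nra.
apply: (@le_trans _ _ (Num.sqrt (8 / (a * c)) * b)); last first.
  have b2 : b <= 2 * (1 - enorm (gamma s)) by rewrite /b; nra.
  by rewrite [2 * _]mulrC -mulrA ler_wpM2l ?sqrtr_ge0.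
apply/ler_addgt0Pr => e e0.
have /cvg_enormP/(_ e e0)[T [_ hT]] := gx.
pose t := Num.max s (Num.max 3 (T + 1)).
have tT : T < t by rewrite /t !lt_max; apply/orP; right; apply/orP; right; lra.
have t3 : 3 <= t by rewrite /t !le_max lexx orbT.
have st : s <= t by rewrite /t le_max lexx.
have t4 : 4 <= expR t by have := expR_ge1Dx t; lra.
have /= := hT t tT; have := near_end t st t4.
by have := enorm_dist_triangle (gamma t) (gamma s) x; lra.
Qed.

Definition radial_ray (R : realType) n (x : 'rV[R]_n) (t : R) : 'rV[R]_n :=
  ((expR t - 1) / (expR t + 1)) *: x.

Lemma expR_ge1 (R : realType) (t : R) : 0 <= t -> 1 <= expR t.
Proof. by move=> t0; have := expR_ge1Dx t; lra. Qed.

Lemma enorm_radial_ray (R : realType) n (x : 'rV[R]_n) (t : R) :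
  enorm x = 1 -> 0 <= t -> enorm (radial_ray x t) = (expR t - 1) / (expR t + 1).
Proof.
move=> x1 /expR_ge1 E1; rewrite enormZ x1 mulr1 ger0_norm //.
by rewrite divr_ge0; lra.
Qed.

Lemma radial_ray_hyp (R : realType) n (x : 'rV[R]_n) (t : R) :
  enorm x = 1 -> 0 <= t -> hyp_space R n (radial_ray x t).
Proof.
move=> x1 t0; rewrite /hyp_space /= enorm_radial_ray //.
by have := expR_ge1 t0 => E1; rewrite ltr_pdivrMr; lra.
Qed.

Lemma radial_ray_geodesic (R : realType) n (x : 'rV[R]_n) :
  enorm x = 1 -> geodesic_ray (radial_ray x).
Proof.
move=> x1; split=> [t|s t] => [|s0 t0]; first exact: radial_ray_hyp.
rewrite /hdist !enorm_radial_ray // /radial_ray -scalerBl enormZ x1 mulr1.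
rewrite real_normK ?num_real // -arcosh_expR opprB !expRD !expRN; congr arcosh.
have s1 := expR_ge1 s0; have t1 := expR_ge1 t0.
field; rewrite !lt0r_neq0 //=; lra.
Qed.

Lemma radial_ray_lands (R : realType) n (x : 'rV[R]_n) :
  enorm x = 1 -> lands_at (radial_ray x) x.
Proof.
move=> x1; apply/cvg_enormP => e e0.
exists (2 / e); split; first exact: num_real.
move=> t te /=.
have t0 : 0 < t by apply: lt_trans te; rewrite divr_gt0.
have E1 := expR_ge1Dx t.
rewrite -[X in _ - X]scale1r -scalerBl enormZ x1 mulr1.
have -> : (expR t - 1) / (expR t + 1) - 1 = - (2 / (expR t + 1)).
  by field; rewrite lt0r_neq0; lra.
rewrite normrN ger0_norm; last by rewrite divr_ge0; lra.
rewrite ltr_pdivrMr; last by lra.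
by move: te; rewrite ltr_pdivrMr // => te; nra.
Qed.

(** The Euclidean counterpart of conical accumulation at a point of the sphere:
    a fixed Stolz cone replaces the neighbourhood of a geodesic ray. *)
Definition stolz_limit (R : realType) n (W : set 'rV[R]_n) (x : 'rV[R]_n) :=
  exists M : R, forall e, 0 < e ->
    exists z, [/\ W z, enorm (z - x) < e & enorm (z - x) <= M * (1 - enorm z)].

(** A point at bounded distance from [gamma t] has comparable height and is at
    Euclidean distance comparable to it from [gamma t], which itself lies in a
    Stolz cone. *)
Lemma conical_stolz (R : realType) n (W : set 'rV[R]_n) (x : 'rV[R]_n) :
  W `<=` hyp_space R n -> conical_limit_set W x -> stolz_limit W x.
Proof.
move=> WH [x1 [z [Wz [zx [gamma [gH gx [C hC]]]]]]].
have [K1 K10 hK1] := geodesic_ray_stolz gH gx.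
have zH k : hyp_space R n (z k) by apply: WH.
pose K := 4 * expR (C + 1); have K0 : 0 <= K by rewrite mulr_ge0 ?expR_ge0.
pose L := 2 + 4 * K; have L0 : 0 <= L by rewrite /L; lra.
exists (Num.sqrt (K * L) + K1 * L) => e e0.
have /cvg_enormP/(_ e e0)[N _ /(_ N (leqnn N)) /= zNe] := zx.
exists (z N); split => //.
have [t t0 ht] : exists2 t, 0 <= t & hdist (z N) (gamma t) <= C + 1.
  have hinf : has_inf [set hdist (z N) (gamma t) | t in [set t : R | 0 <= t]].
    split; first by exists (hdist (z N) (gamma 0)), 0 => /=.
    by exists 0 => _ [t /= t0 <-]; apply: hdist_ge0 => //; apply: gH.1.
  have [_ [t /= t0 <-] ht] := inf_adherent (@ltr01 R) hinf.
  exists t => //; have := hC N; rewrite /dist_to_ray; lra.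
have gtH : hyp_space R n (gamma t) by apply: gH.1.
have h1 := dist_le_hdist (zH N) gtH ht; rewrite -/K in h1.
have h2 := height_comparable (zH N) gtH K0 h1; rewrite -/L in h2.
have p0 : 0 < 1 - enorm (z N) by have := zH N; rewrite /hyp_space /=; lra.
have h3 : enorm (z N - gamma t) <= Num.sqrt (K * L) * (1 - enorm (z N)).
  have sK : Num.sqrt (K * L) ^+ 2 = K * L by rewrite sqr_sqrtr // mulr_ge0.
  apply: sqr_le; first by rewrite mulr_ge0 ?sqrtr_ge0 // ltW.
  rewrite exprMn sK; apply: le_trans h1 _.
  have := ler_wpM2l K0 (ler_wpM2l (ltW p0) h2); lra.
have h4 := hK1 t t0.
have h5 : K1 * (1 - enorm (gamma t)) <= K1 * (L * (1 - enorm (z N))).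
  by rewrite ler_wpM2l.
by have := enorm_dist_triangle (gamma t) (z N) x; lra.
Qed.

(** The radial ray serves for every Stolz cone: a point of the cone is at bounded
    distance from the point of the ray at the same height. *)
Lemma stolz_conical (R : realType) n (W : set 'rV[R]_n) (x : 'rV[R]_n) :
  W `<=` hyp_space R n -> enorm x = 1 -> stolz_limit W x ->
  conical_limit_set W x.
Proof.
move=> WH x1 [M hM]; split=> //.
have e0 k : (0 : R) < k.+1%:R^-1 by rewrite invr_gt0 ltr0n.
pose z k := projT1 (cid (hM _ (e0 k))).
have hz k : [/\ W (z k), enorm (z k - x) < k.+1%:R^-1 &
    enorm (z k - x) <= M * (1 - enorm (z k))] := projT2 (cid (hM _ (e0 k))).
exists z; split; first by move=> k; have [] := hz k.
split.
  apply/cvg_enormP => e e_gt0.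
  have [N hN] := exists_invS_lt e_gt0.
  by exists N => // k /= /hN eN; have [_ /lt_trans h _] := hz k; apply: h.
exists (radial_ray x); split.
- exact: radial_ray_geodesic.
- exact: radial_ray_lands.
exists (ln (2 * (1 + 2 * (M + 1) ^+ 2))) => k.
have [/WH zH _ zM] := hz k; have := zH; rewrite /hyp_space /=.
move: (z k) zH zM => {hz}w wH wM w1; have w0 := enorm_ge0 w.
(* The parameter at which the radial ray has the same height as [w]. *)
pose t : R := ln ((1 + enorm w) / (1 - enorm w)).
have q0 : 0 < 1 - enorm w by lra.
have t0 : 0 <= t by apply: ln_ge0; rewrite ler_pdivlMr //; lra.
have Et : expR t = (1 + enorm w) / (1 - enorm w).
  by rewrite lnK // posrE divr_gt0 //; lra.
have rayt : radial_ray x t = enorm w *: x.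
  rewrite /radial_ray Et; congr (_ *: _); field.
  by rewrite !lt0r_neq0; lra.
apply: (@le_trans _ _ (hdist w (radial_ray x t))).
  apply: ge_inf; last by exists t => /=.
  by exists 0 => _ [s /= s0 <-]; apply: hdist_ge0 => //; apply: radial_ray_hyp.
have rH := radial_ray_hyp x1 t0.
apply: arcosh_le; first exact: cosh_hdist_arg.
have d1 : enorm (w - enorm w *: x) <= (M + 1) * (1 - enorm w).
  have xw : enorm (x - enorm w *: x) = 1 - enorm w.
    by rewrite -{1}[x]scale1r -scalerBl enormZ x1 mulr1 ger0_norm // ltW.
  by have := enorm_dist_triangle x w (enorm w *: x); lra.
rewrite lerD2l -mulrA ler_pM2l // rayt enormZ x1 mulr1 ger0_norm //.
have e1 : 0 < 1 - enorm w ^+ 2 by apply: ball_sq.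
rewrite ler_pdivrMr ?mulr_gt0 //.
have d2 : enorm (w - enorm w *: x) ^+ 2 <= ((M + 1) * (1 - enorm w)) ^+ 2.
  rewrite lerXn2r ?nnegrE ?enorm_ge0 //.
  by apply: le_trans d1; apply: enorm_ge0.
apply: le_trans d2 _; rewrite exprMn ler_wpM2l ?sqr_ge0 // expr2.
have e2 : 1 - enorm w <= 1 - enorm w ^+ 2 by nra.
by apply: ler_pM => //; apply: ltW.
Qed.

(** * Half-spaces, hulls and caps of the sphere *)

(** Rational parametrisation of the rotation of [p] towards [v]; [tau] is the
    tangent of half of the angle. *)
Lemma rotated_unit (R : realType) n (p v : 'rV[R]_n) (tau : R) :
  enorm p = 1 -> enorm v = 1 -> dot p v = 0 -> 0 <= tau <= 1 ->
  exists y, [/\ enorm y = 1, tau <= dot v y & tau <= enorm (y - p) <= 2 * tau].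
Proof.
move=> p1 v1 pv /andP[t0 t1].
have pp : dot p p = 1 by rewrite -enorm_sq p1 expr1n.
have vv : dot v v = 1 by rewrite -enorm_sq v1 expr1n.
have tt0 := sqr_ge0 tau; have tt1 : tau ^+ 2 <= 1 by nra.
have D0 : 0 < 1 + tau ^+ 2 by lra.
pose y := (1 + tau ^+ 2)^-1 *: ((1 - tau ^+ 2) *: p + (2 * tau) *: v).
have y1 : enorm y = 1.
  have : enorm y ^+ 2 = 1.
    rewrite enorm_sq /y !dotE pp vv (dotC v p) pv.
    by field; rewrite lt0r_neq0.
  by have := enorm_ge0 y; nra.
have vy : dot v y = 2 * tau / (1 + tau ^+ 2).
  by rewrite /y !dotE vv (dotC v p) pv; field; rewrite lt0r_neq0.
have py : enorm (y - p) ^+ 2 = 4 * tau ^+ 2 / (1 + tau ^+ 2).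
  rewrite enorm_distE y1 p1 (dotC y p) /y !dotE pp pv.
  by field; rewrite lt0r_neq0.
exists y; split => //; first by rewrite vy ler_pdivlMr //; nra.
apply/andP; split; apply: sqr_le; rewrite ?enorm_ge0 ?mulr_ge0 // py.
  by rewrite ler_pdivlMr //; move: (tau ^+ 2) tt0 tt1 => T T0 T1; nra.
by rewrite ler_pdivrMr // exprMn; move: (tau ^+ 2) tt0 tt1 => T T0 T1; nra.
Qed.

(** The three kinds of half-spaces correspond to [a = 0], [a = 1], [a = -1]. *)
Lemma closed_half_spaceE (R : realType) n (P : set 'rV[R]_n) :
  closed_half_space P -> exists (a : R) (u : 'rV[R]_n),
    P = hyp_space R n `&` [set z | a * (1 + enorm z ^+ 2) <= 2 * dot u z].
Proof.
case=> [[u _ ->]|[c [r [r0 cr Pcr]]]].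
  exists 0, u; congr (_ `&` _); apply/seteqP; split=> z /=; lra.
have sph z : enorm (z - c) ^+ 2 = enorm z ^+ 2 + (1 + r ^+ 2) - 2 * dot c z.
  by rewrite enorm_distE cr (dotC z c).
have d0 z := enorm_ge0 (z - c).
case: Pcr => ->.
  exists 1, c; congr (_ `&` _); apply/seteqP; split=> z /=; have := sph z; have := d0 z.
    by move=> dz e /(le_sqr dz); lra.
  by move=> dz e zr; apply: sqr_le; [exact: ltW | lra].
exists (-1), (- c); congr (_ `&` _); apply/seteqP; split=> z /=; have := sph z;
    have := d0 z; rewrite dotNl.
  by move=> dz e /(le_sqr (ltW r0)); lra.
by move=> dz e zr; apply: sqr_le; lra.
Qed.

Lemma closure_half_space (R : realType) n (a : R) (u x : 'rV[R]_n) :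
  enorm x = 1 ->
  closure (hyp_space R n `&` [set z | a * (1 + enorm z ^+ 2) <= 2 * dot u z]) x ->
  a <= dot u x.
Proof.
move=> x1 /closure_enormP cx; apply/ler_addgt0Pr => e e0.
have L0 : 0 < enorm u + `|a| + 1 by have := enorm_ge0 u; have := normr_ge0 a; lra.
have [|y [yH /= ay] yx] := cx (e / (enorm u + `|a| + 1)); first by rewrite divr_gt0.
move: yx; rewrite ltr_pdivlMr // => yx.
have d0 := enorm_ge0 (y - x); have u0 := enorm_ge0 u; have y0 := enorm_ge0 y.
have a0 := normr_ge0 a; have aa := ler_norm (- a); have aa' := ler_norm a.
rewrite normrN in aa.
have : dot u y - dot u x <= enorm u * enorm (y - x).
  by have := Cauchy_Schwarz u (y - x); rewrite !dotE.
have h : 1 - enorm y <= enorm (y - x).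
  by have := enorm_le_dist x y; rewrite x1 enorm_distC; lra.
have yH1 : enorm y < 1 by [].
have h2 : a * (1 - enorm y ^+ 2) <= `|a| * (2 * enorm (y - x)).
  have h3 : 0 <= 1 - enorm y ^+ 2 <= 2 * enorm (y - x) by apply/andP; split; nra.
  by case/andP: h3 => h3 h4; nra.
by move: ay; nra.
Qed.

(** A half-space bounded by a sphere orthogonal to the unit sphere and centred
    on the ray through [p]; its ideal boundary is the complement of a cap
    around [p]. *)
Lemma off_cap_half_space (R : realType) n (p : 'rV[R]_n) (s : R) :
  enorm p = 1 -> 0 < s < 1 ->
  closed_half_space
    (hyp_space R n `&` [set z | 2 * dot p z <= s * (1 + enorm z ^+ 2)]).
Proof.
move=> p1 /andP[s0 s1]; right.
have r20 : 0 < s^-1 ^+ 2 - 1.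
  have : 1 < s^-1 by rewrite invf_gt1.
  by nra.
exists (s^-1 *: p), (Num.sqrt (s^-1 ^+ 2 - 1)).
have r2 : Num.sqrt (s^-1 ^+ 2 - 1) ^+ 2 = s^-1 ^+ 2 - 1 by rewrite sqr_sqrtr // ltW.
have c1 : enorm (s^-1 *: p) = s^-1 by rewrite enormZ p1 mulr1 ger0_norm // invr_ge0 ltW.
split; first by rewrite sqrtr_gt0.
  by rewrite r2 c1; ring.
right; congr (_ `&` _); apply/seteqP; split=> z /=;
  have := enorm_distE z (s^-1 *: p); rewrite c1 dotZr (dotC z p);
  have := enorm_ge0 (z - s^-1 *: p); have := sqrtr_ge0 (s^-1 ^+ 2 - 1);
  move: r2; move: (Num.sqrt _) (enorm (z - _)) => r d r2 r0 d0 h.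
- move=> hz; apply: sqr_le => //; rewrite r2 h.
  have : s^-1 * (2 * dot p z) <= 1 + enorm z ^+ 2 by rewrite ler_pdivrMl.
  by lra.
- move=> rd; have : r ^+ 2 <= d ^+ 2 by apply: le_sqr.
  rewrite r2 h => h'; rewrite -ler_pdivrMl //; lra.
Qed.

(** The points [t x] with [t] below [1] stay in the half-space because
    [2 t <= 1 + t^2]. *)
Lemma closure_off_cap (R : realType) n (p x : 'rV[R]_n) (s : R) :
  0 <= s -> enorm x = 1 -> dot p x <= s ->
  closure (hyp_space R n `&` [set z | 2 * dot p z <= s * (1 + enorm z ^+ 2)]) x.
Proof.
move=> s0 x1 pxs; apply/closure_enormP => e e0.
pose t : R := Num.min (1 / 2) (e / 2).
have t0 : 0 < t by rewrite /t lt_min; lra.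
have [t1 te] : t <= 1 / 2 /\ t <= e / 2 by rewrite /t !ge_min !lexx orbT.
have nx : enorm ((1 - t) *: x) = 1 - t by rewrite enormZ x1 mulr1 ger0_norm; lra.
exists ((1 - t) *: x).
  split; first by rewrite /hyp_space /= nx; lra.
  by rewrite /= nx dotZr; nra.
rewrite -{2}[x]scale1r -scalerBl enormZ x1 mulr1 ler0_norm; lra.
Qed.

(** A point [w] of the hull is not cut off from [F] by the half-space over the
    cap of radius comparable to the height of [w]. *)
Lemma hull_shadow (R : realType) n (F : set 'rV[R]_n) (w : 'rV[R]_n) :
  F `<=` ideal_sphere R n -> 0 < enorm w -> hyp_hull F w ->
  exists2 x, F x & enorm (x - w) <= 3 * (1 - enorm w).
Proof.
move=> FS w0 [wH hw]; apply: contrapT => nx.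
have wH1 : enorm w < 1 by [].
pose p := (enorm w)^-1 *: w.
have wn0 : w != 0 by apply: contraTneq w0 => ->; rewrite enorm0 ltxx.
have p1 : enorm p = 1 by apply: enorm_normalized.
have wE : w = enorm w *: p by rewrite scalerA divff ?scale1r // lt0r_neq0.
have pw : dot p w = enorm w by rewrite wE dotZr -enorm_sq p1 expr1n mulr1 -wE.
have dwp : enorm (w - p) = 1 - enorm w.
  by rewrite {1}wE -{2}[p]scale1r -scalerBl enormZ p1 mulr1 ler0_norm; lra.
(* The cap [p.x > s] has radius [sqrt 2] times the height of [w], which is
   enough for [w] to lie off the half-space. *)
pose s := 1 - (1 - enorm w) ^+ 2.
have s01 : 0 < s < 1 by apply/andP; split; rewrite /s; nra.
have : 2 * dot p w <= s * (1 + enorm w ^+ 2).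
  have [] // := hw (hyp_space R n `&` [set z | 2 * dot p z <= s * (1 + enorm z ^+ 2)]).
  split; first exact: off_cap_half_space.
  move=> x Fx; have x1 : enorm x = 1 by apply: FS.
  apply: closure_off_cap => //; first by case/andP: s01 => /ltW.
  have xw : 3 * (1 - enorm w) < enorm (x - w).
    by rewrite ltNge; apply/negP => xw; apply: nx; exists x.
  have := enorm_dist_triangle p x w; rewrite (enorm_distC p w) dwp.
  have := enorm_distE x p; rewrite x1 p1 (dotC x p) /s.
  move=> e1 e2; have : (2 * (1 - enorm w)) ^+ 2 <= enorm (x - p) ^+ 2.
    by apply: le_sqr; lra.
  by rewrite e1; nra.
have : 0 < ((1 - enorm w) * enorm w) ^+ 2 by rewrite exprn_gt0 // mulr_gt0 // subr_gt0.
by rewrite pw /s; lra.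
Qed.

Lemma not_hull_separated (R : realType) n (F : set 'rV[R]_n) (z : 'rV[R]_n) :
  F `<=` ideal_sphere R n -> hyp_space R n z -> ~ hyp_hull F z ->
  exists (a : R) (u : 'rV[R]_n), 2 * dot u z < a * (1 + enorm z ^+ 2) /\
    forall x, F x -> a <= dot u x.
Proof.
move=> FS zH nz.
have [P [[hP FP] nPz]] : exists P, (closed_half_space P /\ F `<=` closure P) /\ ~ P z.
  apply: contrapT => h; apply: nz; split=> // P hP.
  by apply: contrapT => nP; apply: h; exists P.
have [a [u PE]] := closed_half_spaceE hP; exists a, u; split.
  by rewrite ltNge; apply/negP => h; apply: nPz; rewrite PE.
by move=> x Fx; apply: closure_half_space; [exact: FS | rewrite -PE; apply: FP].
Qed.

(** The open half-space of the points [z] with [2 u.z < a (1 + |z|^2)] has as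
    ideal boundary the cap of the [y] with [u.y < a]. Write
    [u = beta p - sigma v] with [p] the direction of [z], [v] a unit vector
    orthogonal to [p] and [sigma >= 0]: turning away from [p] towards [v]
    decreases [u.y], and an angle of the order of the height of [z] suffices to
    enter the cap robustly, whatever the sign of [beta]. *)
Lemma cap_near_half_space (R : realType) m (a : R) (u z : 'rV[R]_m.+1) :
  (1 <= m)%N -> 2 / 3 <= enorm z -> enorm z < 1 ->
  2 * dot u z < a * (1 + enorm z ^+ 2) ->
  exists y0, [/\ enorm y0 = 1, enorm (y0 - z) <= 7 * (1 - enorm z) &
    forall y, enorm y = 1 -> enorm (y - y0) <= (1 - enorm z) / 4 -> dot u y < a].
Proof.
move=> m1 z23 z1 hz; set d := 1 - enorm z.
have d0 : 0 < d by rewrite /d; lra.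
have d1 : d <= 1 / 3 by rewrite /d; lra.
have z0 : z != 0.
  by apply: contraTneq z23 => ->; rewrite enorm0 -ltNge; lra.
have [p p1 zE] : exists2 p, enorm p = 1 & z = enorm z *: p.
  exists ((enorm z)^-1 *: z); first exact: enorm_normalized.
  by rewrite scalerA divff ?scale1r // lt0r_neq0; lra.
have pp : dot p p = 1 by rewrite -enorm_sq p1 expr1n.
have dzp : enorm (p - z) = d.
  rewrite [X in p - X]zE -{1}[p]scale1r -scalerBl enormZ p1 mulr1 ger0_norm //; exact: ltW.
pose beta := dot u p.
have [v [v1 pv [sigma sigma0 uE]]] : exists v, [/\ enorm v = 1, dot p v = 0 &
    exists2 sigma : R, 0 <= sigma & u = beta *: p - sigma *: v].
  have [q0|qn0] := eqVneq (u - beta *: p) 0.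
    have [v v1 pv] := unit_orthogonal m1 p1; exists v; split=> //.
    by exists 0; rewrite // scale0r subr0; apply/eqP; rewrite -subr_eq0 q0.
  pose q := u - beta *: p.
  exists (- ((enorm q)^-1 *: q)); split.
  - by rewrite enormN enorm_normalized.
  - have pq : dot p q = 0 by rewrite /q !dotE pp (dotC p u) /beta; ring.
    by rewrite dotNr dotZr pq mulr0 oppr0.
  exists (enorm q); first exact: enorm_ge0.
  rewrite scalerN opprK scalerA divff ?scale1r ?subrKC //.
  by apply: contra_neq qn0 => /enorm_eq0.
have uy y : dot u y = beta * dot p y - sigma * dot v y by rewrite uE !dotE.
have py y : enorm y = 1 -> enorm (y - p) ^+ 2 = 2 - 2 * dot p y.
  by move=> y1; rewrite enorm_distE y1 p1 (dotC y p); ring.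
have bz : beta * (2 * enorm z) < a * (1 + enorm z ^+ 2).
  have uz : dot u z = enorm z * beta by rewrite {1}zE dotZr.
  by apply: le_lt_trans hz; rewrite uz; lra.
(* If [beta >= 0], then [p.y] must drop below [1 - d^2], so the turn has to exceed
   [d] clearly; if [beta < 0], then [p.y] must stay above [1 - d^2 / 2], and the
   turn is smaller than [d], yet large enough for the ball of radius [d / 4]
   around [y0] to remain on the side [v.y >= 0]. *)
pose tau := if 0 <= beta then 3 * d else d / 3.
have tau01 : 0 <= tau <= 1 by rewrite /tau; case: ifP => _; apply/andP; split; lra.
have [y0 [y01 vy0 /andP[py0 py0']]] := rotated_unit p1 v1 pv tau01.
exists y0; split=> // [|y y1 yy0].
  have := enorm_dist_triangle p y0 z; rewrite dzp.
  have : tau <= 3 * d by rewrite /tau; case: ifP => _; lra.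
  by lra.
have vy : tau - d / 4 <= dot v y.
  have := Cauchy_Schwarz v (y0 - y); rewrite v1 mul1r enorm_distC !dotE; lra.
have {vy} vy : 0 <= dot v y by move: vy; rewrite /tau; case: ifP => _; lra.
have {}uy : dot u y <= beta * dot p y by rewrite uy gerBl mulr_ge0.
have D0 : 0 < 1 + enorm z ^+ 2 by have := sqr_ge0 (enorm z); lra.
suff h : beta * dot p y * (1 + enorm z ^+ 2) <= beta * (2 * enorm z).
  by rewrite -(ltr_pM2r D0); apply: le_lt_trans bz; apply: le_trans h; rewrite ler_pM2r.
have zd : enorm z = 1 - d by rewrite /d; lra.
have dD : 2 * enorm z = 1 + enorm z ^+ 2 - d ^+ 2 by rewrite zd; ring.
have D2 : 1 + enorm z ^+ 2 <= 2 by nra.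
have D1 : 1 <= 1 + enorm z ^+ 2 by rewrite lerDl sqr_ge0.
have dd0 := sqr_ge0 d.
rewrite -mulrA dD; move: (1 + enorm z ^+ 2) D0 D1 D2 => D D0 D1 D2.
move: tau01 py0 py0' (py _ y1) => _.
rewrite /tau; case: ifP => [b0|/negbT b0] t1 t2 e.
  have h1 : 2 * d <= enorm (y - p).
    by have := enorm_dist_triangle y y0 p; rewrite (enorm_distC y0 y); lra.
  apply: ler_wpM2l => //; have : dot p y <= 1 - 2 * d ^+ 2 by nra.
  by move: (d ^+ 2) dd0 => dd dd0; nra.
have h1 : enorm (y - p) <= d by have := enorm_dist_triangle y0 y p; lra.
have : 1 - d ^+ 2 / 2 <= dot p y by have := enorm_ge0 (y - p); nra.
rewrite -ltNge in b0; move=> h2; apply: ler_wnM2l; first exact: ltW.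
by move: (d ^+ 2) dd0 h2 => dd dd0 h2; nra.
Qed.

(** * The transfinite sequence of derived sets *)

Lemma wo_total (T : Type) (le : rel T) : well_order le ->
  forall b c : T, le b c \/ le c b.
Proof.
move=> wo b c; have [|y [[/asboolP yE yl] _]] := wo (fun y => `[< y = b \/ y = c >]).
  by exists b; apply/asboolP; left.
by case: yE => yE; subst y; [left | right]; apply: yl; apply/asboolP; [right|left].
Qed.

Lemma wo_not_le (T : Type) (le : rel T) : well_order le ->
  forall b c : T, ~ le c b -> wo_lt le b c.
Proof.
move=> wo b c ncb; have [bc|//] := wo_total wo b c; split=> // bcE.
by apply: ncb; rewrite -bcE in bc *.
Qed.

Lemma derive_set_sub (R : realType) n (F : set 'rV[R]_n) : derive_set F `<=` F.
Proof. by move=> x []. Qed.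

Lemma derived_sub (R : realType) n (E : set 'rV[R]_n) (T : Type) (le : rel T)
  (wo : well_order le) (c : T) : derived E wo c `<=` E.
Proof.
elim/(well_founded_ind (wo_lt_wf wo)): c => c IH.
have [lc|nlc] := pselect (wo_least le c); first by rewrite derived_least.
have [[b bc]|nsc] := pselect (exists b, wo_succ le b c).
  rewrite (derived_succ _ _ bc); apply: subset_trans (IH b bc.1).
  exact: derive_set_sub.
rewrite derived_limit //.
have [b /(wo_not_le wo) bc] : exists b, ~ le c b.
  by apply/not_existsP => h; apply: nlc => b; apply: contrapT.
by move=> x /(_ b bc) /(IH b bc).
Qed.

(** The induction is on [c]: if [c] is a successor, then [b] is at most its
    predecessor. *)
Lemma derived_anti (R : realType) n (E : set 'rV[R]_n) (T : Type) (le : rel T)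
    (wo : well_order le) (b c : T) :
  le b c -> derived E wo c `<=` derived E wo b.
Proof.
elim/(well_founded_ind (wo_lt_wf wo)): c => c IH bc.
have [<-//|nbc] := pselect (b = c).
have [lc|nlc] := pselect (wo_least le c).
  by case: nbc; apply: (wo_anti wo) => //; apply: lc.
have [[d dc]|nsc] := pselect (exists d, wo_succ le d c); last first.
  by rewrite (derived_limit E wo nlc nsc) => x; apply.
rewrite (derived_succ _ _ dc); apply: subset_trans (@derive_set_sub _ _ _) _.
apply: IH; first exact: dc.1.
apply: contrapT => /(wo_not_le wo) db; apply: nbc; apply: (wo_anti wo) => //.
exact: dc.2.
Qed.

(** The least index at which [x] has disappeared is a successor. *)
Lemma derived_rank (R : realType) n (E : set 'rV[R]_n) (T : Type) (le : rel T)
    (wo : well_order le) (chi : T) (x : 'rV[R]_n) :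
  derived E wo chi = set0 -> E x ->
  exists c, derived E wo c x /\ ~ derive_set (derived E wo c) x.
Proof.
move=> chi0 Ex.
have [|c [[/asboolP nc cl] _]] := wo (fun c => `[< ~ derived E wo c x >]).
  by exists chi; apply/asboolP; rewrite chi0.
have below b : wo_lt le b c -> derived E wo b x.
  move=> [bc nbc]; apply: contrapT => nb; apply: nbc; apply: (wo_anti wo) => //.
  by apply: cl; apply/asboolP.
have [lc|nlc] := pselect (wo_least le c); first by case: nc; rewrite derived_least.
have [[b bc]|nsc] := pselect (exists b, wo_succ le b c).
  by exists b; split; [apply: below bc.1 | rewrite -(derived_succ E wo bc)].
by case: nc; rewrite derived_limit // => b /below.
Qed.

(** Along a well-order of the uncountable type [set nat] the derived sets cannot
    decrease strictly at every step, for that would inject [set nat], up to its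
    largest element, into the countable set [E]. *)
Lemma derived_stabilizes (R : realType) n (E : set 'rV[R]_n) :
  countable E ->
  (forall (T : Type) (le : rel T) (wo : well_order le) (chi : T),
     derived E wo chi <> set0) ->
  exists F, [/\ F `<=` E, F !=set0 & F `<=` derive_set F].
Proof.
move=> /countable_injP[f finj] ne.
have [le wo] := well_ordering_principle (set nat).
apply: contrapT => nF.
have lost c : exists x, derived E wo c x /\ ~ derive_set (derived E wo c) x.
  apply: contrapT => h; apply: nF; exists (derived E wo c); split.
  - exact: derived_sub.
  - by apply/set0P/eqP; apply: ne.
  - by move=> x cx; apply: contrapT => nx; apply: h; exists x.
have [p hp] := choice lost.
have pE c : p c \in E by apply/mem_set; apply: derived_sub (hp c).1.
pose g c := if pselect (exists d, wo_lt le c d) then (f (p c)).+1 else 0%N.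
have p_lt c d : wo_lt le c d -> p c <> p d.
  move=> cd pcd.
  have [|s [[/asboolP cs sl] _]] := wo (fun s => `[< wo_lt le c s >]).
    by exists d; apply/asboolP.
  have succ : wo_succ le c s.
    by split=> // b cb; apply: sl; apply/asboolP.
  apply: (hp c).2; rewrite -(derived_succ E wo succ) pcd.
  by apply: derived_anti (hp d).1; apply: sl; apply/asboolP.
have ginj c d : g c = g d -> c = d.
  rewrite /g => gE; apply: contrapT => ncd.
  have [cd|dc] : wo_lt le c d \/ wo_lt le d c.
    by have [] := wo_total wo c d; [left|right]; split=> //; apply: nesym.
  - move: gE; case: pselect => [exc|[]]; last by exists d.
    case: pselect => [exd|nexd] // -[] fE.
    by apply: (p_lt c d) => //; apply: finj.
  - move: gE; case: (pselect (exists _, wo_lt le d _)) => [exd|[]]; last by exists c.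
    case: pselect => [exc|nexc] // -[] fE.
    by apply: (p_lt d c) => //; apply/esym/finj.
(* Cantor's diagonal set. *)
pose A : set nat := [set k | exists2 c, g c = k & ~ c k].
have nA : ~ A (g A) by move=> hA; have [c /ginj cA nc] := hA; rewrite cA in nc.
by apply: (nA); exists A.
Qed.

(** * Sets without proper derivation *)

Lemma stolz_hull (R : realType) n (F : set 'rV[R]_n) (x : 'rV[R]_n) (M : R) :
  F `<=` ideal_sphere R n -> derive_set F x ->
  exists2 e : R, 0 < e & forall z, hyp_space R n z -> enorm (z - x) < e ->
    enorm (z - x) <= M * (1 - enorm z) -> hyp_hull F z.
Proof.
move=> FS [Fx nx]; apply: contrapT => h; apply: nx.
apply: stolz_conical; [by move=> z [] | exact: FS |].
exists M => e e0; apply: contrapT => nz; apply: h; exists e => // z zH ze zM.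
by apply: contrapT => nh; apply: nz; exists z.
Qed.

(** A point [z] of the hull at height [d] and at distance about [8 d] from [x]
    has a point of [F] within [3 d], which is therefore distinct from [x]. *)
Lemma derive_set_no_isolated (R : realType) m (F : set 'rV[R]_m.+1) x (r : R) :
  (1 <= m)%N -> F `<=` ideal_sphere R m.+1 -> F `<=` derive_set F -> F x ->
  0 < r -> exists x', [/\ F x', x' <> x & enorm (x' - x) <= r].
Proof.
move=> m1 FS FF Fx r0; have x1 : enorm x = 1 by apply: FS.
have [e e0 he] := stolz_hull 17 FS (FF x Fx).
pose d := Num.min (1 / 8) (Num.min (e / 20) (r / 20)).
have d0 : 0 < d by rewrite /d !lt_min !divr_gt0.
have [d1 de dr] : [/\ d <= 1 / 8, d <= e / 20 & d <= r / 20].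
  by rewrite /d !ge_min !lexx !orbT.
have [v v1 xv] := unit_orthogonal m1 x1.
have t01 : 0 <= 8 * d <= 1 by apply/andP; split; lra.
have [y [y1 _ /andP[yx yx']]] := rotated_unit x1 v1 xv t01.
pose z := (1 - d) *: y.
have nz : enorm z = 1 - d by rewrite enormZ y1 mulr1 ger0_norm; lra.
have yz : enorm (y - z) = d.
  by rewrite /z -{1}[y]scale1r -scalerBl enormZ y1 mulr1 opprB subrKC gtr0_norm.
have zx : enorm (z - x) <= 17 * d.
  by have := enorm_dist_triangle y z x; rewrite (enorm_distC z y); lra.
have zh : hyp_hull F z.
  by apply: he; rewrite /hyp_space /= ?nz; lra.
have [|x' Fx' x'z] := hull_shadow FS _ zh; first by rewrite nz; lra.
rewrite nz in x'z.
exists x'; split=> // [x'x|]; last by have := enorm_dist_triangle z x' x; lra.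
move: x'z; rewrite x'x.
by have := enorm_dist_triangle z y x; rewrite (enorm_distC z x); lra.
Qed.

(** One step of the Baire argument: move to a point [x1] of [F] other than [e0],
    then to the shadow of a point [w] of [W] so close to [x1], within a cone at
    [x1], that [w] lies in the hull of [F]. The new radius is the height of
    [w]. *)
Lemma shrink_ball (R : realType) m (W F : set 'rV[R]_m.+1) (x e0 : 'rV[R]_m.+1)
    (r eta : R) :
  (1 <= m)%N -> W `<=` hyp_space R m.+1 -> F `<=` conical_limit_set W ->
  F `<=` derive_set F -> F x -> 0 < r -> 0 < eta ->
  exists (x' : 'rV[R]_m.+1) (r' : R),
    [/\ F x', 0 < r' < eta, enorm (x' - x) + r' <= r, r' < enorm (e0 - x') &
      exists2 w, W w & forall y, enorm (y - x') <= r' ->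
        enorm (w - y) < eta /\ enorm (w - y) <= 4 * (1 - enorm w)].
Proof.
move=> m1 WH FW FF Fx r0 eta0.
have FS : F `<=` ideal_sphere R m.+1 by move=> y /FW[].
have [x1 [Fx1 x1e x1x]] : exists x1, [/\ F x1, x1 <> e0 & enorm (x1 - x) <= r / 2].
  have [xe|xe] := pselect (x = e0).
    by rewrite -xe; apply: derive_set_no_isolated; rewrite ?divr_gt0.
  by exists x; split=> //; rewrite subrr enorm0 divr_ge0 // ltW.
have rho0 : 0 < enorm (x1 - e0).
  rewrite lt_neqAle enorm_ge0 andbT eq_sym; apply/eqP => /enorm_eq0 h.
  by apply: x1e; apply/eqP; rewrite -subr_eq0 h.
have [M hM] := conical_stolz WH (FW _ Fx1).
have [e ep he] := stolz_hull M FS (FF _ Fx1).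
pose e' := Num.min (1 / 2) (Num.min e
  (Num.min (r / 10) (Num.min (enorm (x1 - e0) / 8) (eta / 8)))).
have e'0 : 0 < e' by rewrite /e' !lt_min !divr_gt0 // ep.
have [e1 e2] : e' <= 1 / 2 /\ e' <= e by rewrite /e' !ge_min !lexx !orbT.
have [e3 e4 e5] : [/\ e' <= r / 10, e' <= enorm (x1 - e0) / 8 & e' <= eta / 8].
  by rewrite /e' !ge_min !lexx !orbT.
have [w [Ww wx wM]] := hM e' e'0.
have wH : enorm w < 1 by apply: WH.
have [|||x' Fx' x'w] := hull_shadow FS _ (he w _ _ wM).
- by have := enorm_le_dist x1 w; rewrite (FS _ Fx1) enorm_distC; lra.
- exact: WH.
- exact: lt_le_trans wx e2.
have dw : 1 - enorm w <= enorm (w - x1).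
  by have := enorm_le_dist x1 w; rewrite (FS _ Fx1) enorm_distC; lra.
have x'x1 := enorm_dist_triangle w x' x1.
exists x', (1 - enorm w); split=> //.
- by apply/andP; split; lra.
- by have := enorm_dist_triangle x1 x' x; lra.
- have := enorm_dist_triangle x' x1 e0.
  by rewrite (enorm_distC x1 x') (enorm_distC x' e0); lra.
exists w => // y yx'; have := enorm_dist_triangle x' w y.
by rewrite (enorm_distC w x') (enorm_distC x' y); split; lra.
Qed.

(** Balls centred in [F] are nested so that the [k]-th one avoids the [k]-th
    point of [E] and lies in the shadow of a point of [W] of height less than
    [1 / (k + 1)]. Their common point is then a conical limit point of [W] that
    is not in [E]. *)
Lemma no_countable_perfect (R : realType) m (W E F : set 'rV[R]_m.+1) :
  (1 <= m)%N -> W `<=` hyp_space R m.+1 -> E = conical_limit_set W ->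
  countable E -> F `<=` E -> F !=set0 -> ~ (F `<=` derive_set F).
Proof.
move=> m1 WH EW /countable_injP[f finj] FE [x0 Fx0] FF.
have FW : F `<=` conical_limit_set W by rewrite -EW.
have [e he] : {e : nat -> 'rV[R]_m.+1 & forall k x, E x -> f x = k -> e k = x}.
  apply: (choice (P := fun k v => forall x, E x -> f x = k -> v = x)) => k.
  have [[x [Ex fx]]|nx] := pselect (exists x, E x /\ f x = k).
    by exists x => x' Ex' fx'; apply: finj; rewrite ?inE // fx fx'.
  by exists 0 => x Ex fx; case: nx; exists x.
pose eta k : R := k.+1%:R^-1.
have eta0 k : 0 < eta k by rewrite invr_gt0 ltr0n.
pose good (p : 'rV[R]_m.+1 * R) := F p.1 /\ 0 < p.2.
pose next (kp : nat * ('rV[R]_m.+1 * R)) (q : 'rV[R]_m.+1 * R) :=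
  good kp.2 -> [/\ F q.1, 0 < q.2 < eta kp.1,
    enorm (q.1 - kp.2.1) + q.2 <= kp.2.2, q.2 < enorm (e kp.1 - q.1) &
    exists2 w, W w & forall y, enorm (y - q.1) <= q.2 ->
      enorm (w - y) < eta kp.1 /\ enorm (w - y) <= 4 * (1 - enorm w)].
have [g hg] : {g & forall kp, next kp (g kp)}.
  apply: (choice (P := next)) => -[k [x r]]; have [[Fx r0]|ng] := pselect (good (x, r)).
    have [x' [r' h]] := shrink_ball (e k) m1 WH FW FF Fx r0 (eta0 k).
    by exists (x', r').
  by exists (x, r) => /ng.
pose p := fix p k := if k is k'.+1 then g (k', p k') else (x0, 1).
have pgood k : good (p k).
  elim: k => [|k IH]; first by split => //=; exact: ltr01.
  by have [? /andP[? _] _ _ _] := hg (k, p k) IH.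
have [||k|y hy] := @nested_balls _ _ (fun k => (p k).1) (fun k => (p k).2).
- by move=> k; have [] := pgood k.
- move=> c /exists_invS_lt[N /(_ N (leqnn N)) hN].
  exists N.+1; have [_ /andP[_ h] _ _ _] := hg (N, p N) (pgood N).
  exact: lt_trans h hN.
- by have [] := hg (k, p k) (pgood k).
have small c : 0 < c -> exists N, eta N < c.
  by move=> /exists_invS_lt[N hN]; exists N; apply: hN.
have y1 : enorm y = 1.
  apply/eqP; rewrite eq_le; apply/andP; split; apply/ler_addgt0Pr => c /small[N etaN];
    have [Fx /andP[_ h] _ _ _] := hg (N, p N) (pgood N);
    have x1 : enorm (p N.+1).1 = 1 by have [] := FW _ Fx.
  - have := enorm_le_dist y (p N.+1).1; have := hy N.+1; move: h => /=; rewrite x1; lra.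
  - have := enorm_le_dist (p N.+1).1 y; rewrite x1 enorm_distC; have := hy N.+1.
    by move: h => /=; lra.
have Ey : E y.
  rewrite EW; apply: stolz_conical => //; exists 4 => c /small[N etaN].
  have [_ _ _ _ [w Ww hw]] := hg (N, p N) (pgood N).
  have [w1 w2] := hw y (hy N.+1).
  by exists w; split=> //; apply: lt_trans w1 etaN.
have [_ _ _ + _] := hg (f y, p (f y)) (pgood (f y)).
by rewrite /= (he _ _ Ey erefl) ltNge => /negP; apply; apply: (hy (f y).+1).
Qed.

(** * Realising a set whose derived sets vanish *)

(** A point [z] outside the hull is near the centre [y0] of a ball of the sphere
    missing [D], of radius comparable to the height of [z]. The point [w] over
    [y0] whose height is smaller than that of [z] by a factor depending on [C]
    alone has its shadow of aperture [C] in this ball, and stays in a cone at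
    [x] whose aperture does not depend on [z]. *)
Lemma deep_points (R : realType) m (D : set 'rV[R]_m.+1) (x : 'rV[R]_m.+1) (C : R) :
  (1 <= m)%N -> D `<=` ideal_sphere R m.+1 -> D x -> ~ derive_set D x -> 0 <= C ->
  exists M : R, forall e, 0 < e -> exists w,
    [/\ hyp_space R m.+1 w, enorm (w - x) < e, enorm (w - x) <= M * (1 - enorm w) &
      exists (a : R) (u : 'rV[R]_m.+1), (forall p, D p -> a <= dot u p) /\
        forall y, enorm y = 1 -> enorm (w - y) <= C * (1 - enorm w) -> dot u y < a].
Proof.
move=> m1 DS Dx nx C0.
have /conical_stolz[|M hM] : conical_limit_set (hyp_space R m.+1 `\` hyp_hull D) x.
- by apply: contrapT => h; apply: nx.
- by move=> z [].
exists ((8 + M) * (4 * (C + 1))) => e e0.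
pose e' := Num.min (1 / 3) (e / 9).
have e'0 : 0 < e' by rewrite /e' lt_min !divr_gt0.
have [e1 e2] : e' <= 1 / 3 /\ e' <= e / 9 by rewrite /e' !ge_min !lexx !orbT.
have [z [[zH nh] zx zM]] := hM e' e'0.
have z1 : enorm z < 1 by [].
have dz : 1 - enorm z <= enorm (z - x).
  by have := enorm_le_dist x z; rewrite (DS _ Dx) enorm_distC; lra.
have [a [u [za Da]]] := not_hull_separated DS zH nh.
have [|y0 [y01 y0z hy0]] := cap_near_half_space m1 _ z1 za; first by lra.
set d := 1 - enorm z in dz zM y0z hy0.
have d0 : 0 < d by rewrite /d; lra.
have d13 : d < 1 / 3 by lra.
have C1 : 0 < 4 * (C + 1) by lra.
pose eta := d / (4 * (C + 1)).
have etaE : eta * (4 * (C + 1)) = d by rewrite /eta divfK // lt0r_neq0.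
have eta0 : 0 < eta by rewrite divr_gt0.
have etad : eta <= d / 4 by nra.
pose w := (1 - eta) *: y0.
have nw : enorm w = 1 - eta by rewrite enormZ y01 mulr1 ger0_norm; lra.
have wy0 : enorm (w - y0) = eta.
  rewrite enorm_distC /w -{1}[y0]scale1r -scalerBl enormZ y01 mulr1.
  by rewrite opprB subrKC gtr0_norm.
have wx : enorm (w - x) <= eta + 7 * d + enorm (z - x).
  by have := enorm_dist_triangle y0 w x; have := enorm_dist_triangle z y0 x; lra.
exists w; split.
- by rewrite /hyp_space /= nw; lra.
- by lra.
- rewrite nw opprB subrKC -mulrA [_ * eta]mulrC etaE; lra.
exists a, u; split=> // y y1; rewrite nw opprB subrKC => wy; apply: hy0 => //.
by have := enorm_dist_triangle w y y0; rewrite (enorm_distC y w); lra.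
Qed.

(** The points chosen for [x] shadow a cap free of the derived set [D] in which
    [x] was last seen, with an aperture [f x] that tends to infinity along [E].
    If points chosen for infinitely many [x] accumulated conically at [y], the
    caps would contain [y], hence all [x'] coming late enough in [E], and each
    such [x'] would have smaller rank than [x]: an infinite descent. *)
Lemma vanishing_derived_CL (R : realType) m (E : set 'rV[R]_m.+1) (T : Type)
    (le : rel T) (wo : well_order le) (chi : T) :
  (1 <= m)%N -> E `<=` ideal_sphere R m.+1 -> countable E ->
  derived E wo chi = set0 -> CL R m E.
Proof.
move=> m1 ES /countable_injP[f finj] chi0.
pose D := derived E wo.
have DS c : D c `<=` ideal_sphere R m.+1.
  by apply: subset_trans ES; apply: derived_sub.
pose chosen x (c : T) (w : nat -> 'rV[R]_m.+1) (M : R) := D c x /\ forall n,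
  [/\ hyp_space R m.+1 (w n), enorm (w n - x) < n.+1%:R^-1,
   enorm (w n - x) < (f x).+1%:R^-1, enorm (w n - x) <= M * (1 - enorm (w n)) &
   exists (a : R) (u : 'rV[R]_m.+1), (forall p, D c p -> a <= dot u p) /\
     forall y, enorm y = 1 -> enorm (w n - y) <= (f x)%:R * (1 - enorm (w n)) ->
       dot u y < a].
have inv0 k : (0 : R) < k.+1%:R^-1 by rewrite invr_gt0 ltr0n.
have [g hg] : {g : 'rV[R]_m.+1 -> T * (nat -> 'rV[R]_m.+1) * R &
    forall x, E x -> chosen x (g x).1.1 (g x).1.2 (g x).2}.
  apply: (choice (P := fun x q => E x -> chosen x q.1.1 q.1.2 q.2)) => x.
  have [Ex|nEx] := pselect (E x); last by exists (chi, fun=> 0, 0) => /nEx.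
  have [c [cx ncx]] := derived_rank chi0 Ex.
  have [M hM] := deep_points m1 (@DS c) cx ncx (ler0n R (f x)).
  have [w hw] := choice (fun k => hM _ (inv0 (maxn k (f x)))).
  exists (c, w, M) => _; split=> //= k; have [wH wx wM wcap] := hw k.
  by split=> //; apply: lt_le_trans wx _;
    rewrite lef_pV2 ?posrE ?ltr0n // ler_nat ltnS ?leq_maxl ?leq_maxr.
pose rk x := (g x).1.1; pose w x := (g x).1.2.
pose W : set 'rV[R]_m.+1 := [set z | exists x k, E x /\ z = w x k].
have WH : W `<=` hyp_space R m.+1.
  by move=> _ [x [k [Ex ->]]]; have [_ /(_ k)[]] := hg x Ex.
have small (e : R) : 0 < e -> exists N : nat, N.+1%:R^-1 < e.
  by move=> /exists_invS_lt[N hN]; exists N; apply: hN.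
exists W => //; apply/seteqP; split=> [y Wy|x Ex]; last first.
  apply: stolz_conical => //; first exact: ES.
  exists (g x).2 => e /small[N hN]; have [_ /(_ N)[_ wx _ wM _]] := hg x Ex.
  exists (w x N); split=> //; first by exists x, N.
  exact: lt_trans wx hN.
have y1 : enorm y = 1 by case: Wy.
have [M hM] := conical_stolz WH Wy.
have height z : hyp_space R m.+1 z -> 0 < 1 - enorm z <= enorm (z - y).
  move=> zH; have z1 : enorm z < 1 by [].
  by have := enorm_le_dist y z; rewrite y1 enorm_distC => ?; apply/andP; split; lra.
apply: contrapT => nEy.
(* The points attached to [x] converge to [x] alone. *)
have away x : E x -> exists2 e, 0 < e & forall k,
    enorm (w x k - y) <= M * (1 - enorm (w x k)) -> e <= enorm (w x k - y).
  move=> Ex; apply: contrapT => h; apply: nEy.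
  have [_ wx] := hg x Ex.
  suff -> : y = x by [].
  apply/eqP; rewrite -subr_eq0; apply/eqP/enorm_eq0.
  apply/eqP; rewrite eq_le enorm_ge0 andbT; apply/ler_addgt0Pr => e e0.
  rewrite add0r.
  have L0 : 0 < 1 + `|(g x).2| by have := normr_ge0 (g x).2; lra.
  have [k wke] : exists k, enorm (w x k - y) < e / (1 + `|(g x).2|).
    apply: contrapT => h'; apply: h; exists (e / (1 + `|(g x).2|)).
      by rewrite divr_gt0.
    by move=> k _; rewrite leNgt; apply/negP => hk; apply: h'; exists k.
  have [wH _ _ wM _] := wx k; have /andP[h1 h2] := height _ wH.
  move: wke; rewrite ltr_pdivlMr // => wke.
  have h3 : (g x).2 * (1 - enorm (w x k)) <= `|(g x).2| * enorm (w x k - y).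
    apply: le_trans (ler_wpM2r (ltW h1) (ler_norm _)) _.
    by apply: ler_wpM2l.
  have := enorm_dist_triangle (w x k) y x; rewrite (enorm_distC y (w x k)) => h4.
  by apply: le_trans h4 _; rewrite -/(w x) in wM; lra.
have away_below K : exists2 e, 0 < e & forall x, E x -> (f x < K)%N -> forall k,
    enorm (w x k - y) <= M * (1 - enorm (w x k)) -> e <= enorm (w x k - y).
  elim: K => [|K [e e0 he]]; first by exists 1.
  have [[x [Ex fx]]|nx] := pselect (exists x, E x /\ f x = K); last first.
    exists e => // x Ex; rewrite ltnS leq_eqVlt => /orP[/eqP fx|]; last exact: he.
    by case: nx; exists x.
  have [e' e'0 he'] := away x Ex.
  exists (Num.min e e'); first by rewrite lt_min e0.
  move=> x' Ex'; rewrite ltnS leq_eqVlt => /orP[/eqP fx'|fx'] k hk.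
    have -> : x' = x by apply: finj; rewrite ?inE // fx fx'.
    rewrite ge_min he' ?orbT //.
    by have -> : x = x' by apply: finj; rewrite ?inE // fx fx'.
  by rewrite ge_min (he x').
(* Hence only points attached to later and later elements approach [y]. *)
have late K e : 0 < e -> exists x k, [/\ E x, (K <= f x)%N, enorm (w x k - y) < e &
    enorm (w x k - y) <= M * (1 - enorm (w x k))].
  move=> e0; have [e' e'0 he'] := away_below K.
  have [|_ [[x [k [Ex ->]]] h1 h2]] := hM (Num.min e e'); first by rewrite lt_min e0.
  move: h1; rewrite lt_min => /andP[h1 h1'].
  exists x, k; split=> //; rewrite leqNgt; apply/negP => fx.
  by have := he' x Ex fx k h2; rewrite leNgt h1'.
have descent c : forall x k, E x -> M <= (f x)%:R -> rk x = c ->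
    enorm (w x k - y) <= M * (1 - enorm (w x k)) -> False.
  elim/(well_founded_ind (wo_lt_wf wo)): c => c IH x k Ex Mf xc hw.
  have [_ /(_ k)[wH _ _ _ [a [u [Da cap]]]]] := hg x Ex.
  have /andP[h1 _] := height _ wH.
  have uy : dot u y < a.
    by apply: cap => //; apply: le_trans hw _; rewrite ler_pM2r.
  have L0 : 0 < enorm u + 1 by have := enorm_ge0 u; lra.
  pose r := (a - dot u y) / (enorm u + 1).
  have r0 : 0 < r by rewrite divr_gt0 // subr_gt0.
  have [N hN] := small (r / 2) (divr_gt0 r0 (ltr0n R 2)).
  have M0 : 0 <= M.
    rewrite -(pmulr_lge0 _ h1); exact: le_trans (enorm_ge0 _) hw.
  have hB := archi_boundP M0.
  have [x' [k' [Ex' fx' wy' hw']]] :=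
    late (maxn N (Num.bound M)) (r / 2) (divr_gt0 r0 (ltr0n R 2)).
  have [Dx' /(_ k')[_ _ wx' _ _]] := hg x' Ex'.
  have x'y : enorm (x' - y) < r.
    have fr : (f x').+1%:R^-1 <= (N.+1%:R^-1 : R).
      by rewrite lef_pV2 ?posrE ?ltr0n // ler_nat ltnS (leq_trans (leq_maxl _ _) fx').
    have := enorm_dist_triangle (w x' k') x' y; rewrite (enorm_distC x' (w x' k')).
    have {wx'} : enorm (w x' k' - x') < r / 2.
      exact: lt_trans (lt_le_trans wx' fr) hN.
    by move=> h2 h3; lra.
  have ux' : dot u x' < a.
    have := Cauchy_Schwarz u (x' - y); rewrite !dotE => h.
    move: x'y; rewrite ltr_pdivlMr // => h'.
    by have := enorm_ge0 (x' - y); lra.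
  apply: (IH (rk x') _ x' k') => //.
    rewrite -xc; apply: (wo_not_le wo) => xx'.
    by have := Da x' (derived_anti xx' Dx'); rewrite leNgt ux'.
  apply/ltW/(lt_le_trans hB); rewrite ler_nat.
  exact: leq_trans (leq_maxr _ _) fx'.
have hB := archi_boundP (normr_ge0 M).
have [x [k [Ex fx _ hw]]] := late (Num.bound `|M|) 1 ltr01.
apply: (descent (rk x) x k) => //; apply: le_trans (ler_norm M) _.
by apply/ltW/(lt_le_trans hB); rewrite ler_nat.
Qed.

(** * Characterisation of countable conical limit sets *)

Theorem theorem1p4 (R : realType) (m : nat) (hm : (1 <= m)%N)
    (E : set 'rV[R]_m.+1) (hE : E `<=` ideal_sphere R m.+1)
    (hcount : countable E) :
  CL R m E <->
  exists (T : Type) (le : rel T) (wo : well_order le) (chi : T),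
    derived E wo chi = set0.
Proof.
split=> [[W WH WE]|[T [le [wo [chi chi0]]]]]; last first.
  exact: vanishing_derived_CL chi0.
apply: contrapT => nchi.
have [|F [FE F0 FF]] := derived_stabilizes hcount.
  by move=> T le wo chi chi0; apply: nchi; exists T, le, wo, chi.
exact: (no_countable_perfect hm WH (esym WE) hcount FE F0 FF).
Qed.
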